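(* Let $\sigma,\theta\in\mathbb{R}$ with $\sigma+\theta\notin\{0,1\}$. The formula $$\beta(\sigma,\theta)=(1-\sigma)\,\mathbf{1}_{\{0<\sigma<1\}}\,\delta_0+\tilde\beta+(1-\theta)\,\mathbf{1}_{\{0<\theta<1\}}\,\delta_1,$$ where $\tilde\beta$ is supported on the real interval with endpoints $x_-$ and $x_+$, $$x_{\pm}=\left(\sqrt{\frac{\sigma}{\sigma+\theta}\left(1-\frac{1}{\sigma+\theta}\right)}\pm\sqrt{\frac{1}{\sigma+\theta}\left(1-\frac{\sigma}{\sigma+\theta}\right)}\right)^2,$$ and has there the density $$\tilde\beta(dx)=(\sigma+\theta)\,\frac{\sqrt{(x-x_-)(x_+-x)}}{2\pi x(1-x)}\,dx,$$ correctly defines a probability measure on $\mathbb{R}$ (the free-binomial distribution) if and only if $(\sigma,\theta)\in G$, where $$G=\left\{(\sigma,\theta)\in\mathbb{R}^2:\ \frac{\sigma+\theta}{\sigma+\theta-1}>0,\ \frac{\sigma\theta}{\sigma+\theta-1}>0\right\}.$$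
   Context: ''The formula correctly defines a probability measure'' means: the endpoints $x_-,x_+$ are real, and the resulting signed measure (atoms plus the part with the given density with respect to Lebesgue measure on the interval with endpoints $x_-,x_+$) is nonnegative with total mass $1$. The square roots of real numbers in the definition of $x_\pm$ are allowed to be purely imaginary (principal branch), so that $x_\pm$ are also real when both radicands are negative; in that case $x_+<x_-$ and the interval is $(x_+,x_-)$. If $x_-=x_+$ then $\tilde\beta=0$. $\delta_a$ is the Dirac mass at $a$ and $\mathbf{1}_{\{\cdot\}}$ is $1$ if the condition holds and $0$ otherwise. *)

(* Defs.v *)
From mathcomp Require Import all_boot all_order all_algebra.
From mathcomp Require Import complex.
From mathcomp Require Import all_classical all_reals all_analysis.

Set Implicit Arguments.
Unset Strict Implicit.
Unset Printing Implicit Defensive.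

Import Order.TTheory GRing.Theory Num.Theory.
Import numFieldNormedType.Exports.

Local Open Scope classical_set_scope.
Local Open Scope ring_scope.
Local Open Scope complex_scope.

Section FreeBinomial.
Context {R : realType}.
Implicit Types sigma theta x : R.

Definition radicand1 sigma theta : R :=
  sigma / (sigma + theta) * (1 - 1 / (sigma + theta)).

Definition radicand2 sigma theta : R :=
  1 / (sigma + theta) * (1 - sigma / (sigma + theta)).

(* [sqrtc] is the principal branch; for a < 0 it sends a%:C to the purely
   imaginary number with imaginary part [Num.sqrt (- a)]. *)
Definition x_minus sigma theta : R[i] :=
  (sqrtc (radicand1 sigma theta)%:C - sqrtc (radicand2 sigma theta)%:C) ^+ 2.

Definition x_plus sigma theta : R[i] :=
  (sqrtc (radicand1 sigma theta)%:C + sqrtc (radicand2 sigma theta)%:C) ^+ 2.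

(* The definitions below are meaningful only when both endpoints are real,
   which [defines_probability] requires; only then are they equal to their
   real parts. *)
Definition xm sigma theta : R := complex.Re (x_minus sigma theta).
Definition xp sigma theta : R := complex.Re (x_plus sigma theta).

(* When both radicands are negative, xp < xm, whence the min and max. *)
Definition fb_interval sigma theta : set R :=
  `]Num.min (xm sigma theta) (xp sigma theta),
    Num.max (xm sigma theta) (xp sigma theta)[.

Definition fb_density sigma theta x : R :=
  (sigma + theta) *
  (Num.sqrt ((x - xm sigma theta) * (xp sigma theta - x))
    / (2 * pi * x * (1 - x))).

Definition fb_ac_part sigma theta (A : set (measurableTypeR R)) : \bar R :=
  (\int[lebesgue_measure]_(x in A `&` fb_interval sigma theta)
     (fb_density sigma theta x)%:E)%E.

Definition fb_formula sigma theta (A : set (measurableTypeR R)) : \bar R :=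
  ((((1 - sigma) * (0 < sigma < 1)%R%:R)%:E * \d_(0%R : measurableTypeR R) A
   + fb_ac_part sigma theta A
   + ((1 - theta) * (0 < theta < 1)%R%:R)%:E
       * \d_(1%R : measurableTypeR R) A))%E.

(* [nu] is the signed measure given by the formula; only its values on
   measurable sets matter. *)
Definition defines_probability sigma theta : Prop :=
  [/\ complex.Im (x_minus sigma theta) = 0,
      complex.Im (x_plus sigma theta) = 0 &
      exists nu : {charge set (measurableTypeR R) -> \bar R},
        [/\ forall A, measurable A -> nu A = fb_formula sigma theta A,
            forall A, measurable A -> (0 <= nu A)%E &
            nu [set: measurableTypeR R] = 1%E]].

Definition fb_region : set (R * R) :=
  [set p | 0 < (p.1 + p.2) / (p.1 + p.2 - 1) /\
           0 < p.1 * p.2 / (p.1 + p.2 - 1)].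

End FreeBinomial.

(* Main.v *)
(* Write D = sigma + theta and let p <= q be the two endpoints. The radicands
   multiply to sigma theta (D - 1) / D^4, so both endpoints are real if and only
   if sigma theta (D - 1) >= 0, and then pq = ((sigma - 1)/D)^2 and
   (1 - p)(1 - q) = ((theta - 1)/D)^2. The substitution
   t = sqrt ((x - p)/(q - x)) turns sqrt ((x - p)(q - x)) / (x (1 - x)) dx into
   a combination of arctangent differentials with total integral
   pi (1 - k0 - k1), where k0 and k1 are square roots of pq and (1 - p)(1 - q)
   with the signs of q and 1 - q. In the region this makes the total mass 1.
   Outside it, either the interval is empty, or 0 < D < 1 and the density is
   nonpositive; in both cases the atoms alone have mass less than 1. *)

Require Import Defs.
From mathcomp Require Import all_boot all_order all_algebra.
From mathcomp Require Import all_classical all_reals all_analysis.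
From mathcomp Require Import complex measurable_realfun ring lra.

Import Order.TTheory GRing.Theory Num.Theory.
Import numFieldNormedType.Exports.

Local Open Scope classical_set_scope.
Local Open Scope complex_scope.
Local Open Scope ring_scope.

(** * Arctangent primitives and the substitution t = sqrt ((x - p) / (q - x)) *)

(* Here n / k is a square root of n / m; for k = 0 the junk value n / 0 = 0 is
   harmless because of the outer factor k. *)
Lemma is_derive_scaled_atan (R : realType) (m n k y : R) :
  k ^+ 2 = m * n -> m + n * y ^+ 2 != 0 ->
  is_derive y (1 : R) (fun y => k * atan (n / k * y)) (m * n / (m + n * y ^+ 2)).
Proof.
move=> kmn d0.
have D : is_derive y (1 : R) (k \*: (@atan R \o ((n / k) \*: id)))
    (k *: ((1 + (n / k * y) ^+ 2)^-1 * (n / k *: 1))).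
  exact: is_deriveZ.
apply: is_derive_eq D _; rewrite /GRing.scale/= mulr1.
have [k0|k0] := eqVneq k 0.
  by rewrite -kmn k0 !mul0r expr0n mul0r.
have m0 : m != 0 by apply: contra_neq k0 => m0; apply/eqP; rewrite -sqrf_eq0 kmn m0 mul0r.
have n0 : n != 0 by apply: contra_neq k0 => n0; apply/eqP; rewrite -sqrf_eq0 kmn n0 mulr0.
have -> : (n / k * y) ^+ 2 = n * y ^+ 2 / m.
  by rewrite exprMn expr_div_n kmn; field; rewrite m0.
by field; rewrite k0 m0 /= d0.
Qed.

(** The sign condition makes n / k positive unless k = 0, so the argument of [atan] tends to +oo. *)
Lemma cvg_scaled_atan (R : realType) (m n k : R) :
  k ^+ 2 = m * n -> 0 <= k * n ->
  k * atan (n / k * y) @[y --> +oo%R] --> k * (pi / 2).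
Proof.
move=> kmn kn0; have [k0|k0] := eqVneq k 0.
  rewrite k0 mul0r; under eq_fun do rewrite mul0r; exact: cvg_cst.
have n0 : n != 0.
  by apply: contra_neq k0 => n0; apply/eqP; rewrite -sqrf_eq0 kmn n0 mulr0.
have r0 : 0 < n / k.
  rewrite lt_neqAle eq_sym mulf_neq0 ?invr_eq0//=.
  rewrite [n / k](_ : _ = k * n / k ^+ 2); last by field.
  by rewrite divr_ge0// sqr_ge0.
apply: cvgMr.
have : n / k * y @[y --> +oo%R] --> +oo%R by apply: gt0_cvgMry.
by move=> /cvg_comp; apply; exact: cvgy_atan.
Qed.

Lemma is_derive_sqrt_quotient (R : realType) (p q x : R) : p < x < q ->
  is_derive x (1 : R) (fun x => Num.sqrt ((x - p) / (q - x)))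
    ((q - p) / (2 * Num.sqrt ((x - p) / (q - x)) * (q - x) ^+ 2)).
Proof.
move=> /andP[px xq].
have xp0 : 0 < x - p by rewrite subr_gt0.
have qx0 : 0 < q - x by rewrite subr_gt0.
have w0 : 0 < (x - p) / (q - x) by rewrite divr_gt0.
have D1 : is_derive x (1 : R) (fun x => (x - p) / (q - x)) ((q - p) / (q - x) ^+ 2).
  have H : is_derive x (1 : R) (fun y : R => (q - y)^-1) (- (q - x) ^- 2 *: (0 - 1)).
    by apply: is_deriveV; rewrite gt_eqF.
  have H0 : is_derive x (1 : R) (fun y : R => y - p) (1 - 0).
    exact: (@is_deriveB _ _ _ id (cst p)).
  have H1 := is_deriveM H0 H.
  apply: is_derive_eq H1 _; rewrite /GRing.scale/=.
  by field; rewrite gt_eqF.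
have D2 := @is_derive1_comp _ Num.sqrt (fun x => (x - p) / (q - x)) x _ _
  (is_derive1_sqrt w0) D1.
apply: is_derive_eq D2 _.
by field; rewrite !gt_eqF// sqrtr_gt0.
Qed.

Lemma cvg_sqrt_quotient (R : realType) (p q : R) : p < q ->
  Num.sqrt ((x - p) / (q - x)) @[x --> q^'-] --> +oo%R.
Proof.
move=> pq; apply/cvgryPge => A; near=> x.
have xq : x < q by near: x; exact: nbhs_left_lt.
have px : p < x by near: x; exact: nbhs_left_gt.
(* Solving (x - p) / (q - x) = A^2 for x gives this bound, a weighted mean of p and q and hence less
   than q. *)
have Ax : (p + A ^+ 2 * q) / (1 + A ^+ 2) < x.
  near: x; apply: nbhs_left_gt.
  rewrite ltr_pdivrMr ?ltr_wpDr ?sqr_ge0//; lra.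
have A1 : 0 < 1 + A ^+ 2 by rewrite ltr_wpDr ?sqr_ge0.
rewrite (le_trans (ler_norm _))// -sqrtr_sqr ler_wsqrtr//.
rewrite ler_pdivlMr ?subr_gt0//.
move: Ax; rewrite ltr_pdivrMr//; lra.
Unshelve. all: by end_near. Qed.

(** * Integration over an open interval from one-sided limits of a primitive *)

(** [f] may be unbounded near the ends: the fundamental theorem is applied on closed intervals
    exhausting []a, b[], and nonnegativity allows passing to the limit by monotone convergence. *)
Lemma ge0_continuous_FTC2_oo (R : realType) (f F : R -> R) (a b la lb : R) :
  a < b ->
  {in `]a, b[, forall x : R, 0 <= f x} ->
  {in `]a, b[, continuous f} ->
  {in `]a, b[, forall x, is_derive x (1 : R) F (f x)} ->
  F x @[x --> a^'+] --> la ->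
  F x @[x --> b^'-] --> lb ->
  (\int[lebesgue_measure]_(x in `]a, b[) (f x)%:E = (lb - la)%:E)%E.
Proof.
move=> ab f0 cf dF Fa Fb.
(* [harmonic n] is 1 / (n + 1), so the factor 1/3 keeps a + e n < b - e n for every n, including n =
   0. *)
pose e n : R := (b - a) / 3 * harmonic n.
have e_gt0 n : 0 < e n.
  by rewrite mulr_gt0 ?divr_gt0 ?subr_gt0 ?harmonic_gt0.
have e_le n : e n <= (b - a) / 3.
  by rewrite ler_piMr ?divr_ge0 ?subr_ge0 ?(ltW ab)// invf_le1 ?ler1n.
have e_cvg : e n @[n --> \oo] --> 0.
  rewrite -[X in _ --> X](mulr0 ((b - a) / 3)).
  by apply: cvgMr; exact: cvg_harmonic.
have e_anti m n : (m <= n)%N -> e n <= e m.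
  move=> mn; rewrite ler_wpM2l ?divr_ge0 ?subr_ge0 ?(ltW ab)//.
  by rewrite lef_pV2 ?posrE// ler_nat.
pose I n : set (measurableTypeR R) := `[a + e n, b - e n]%classic.
have ltI n : a + e n < b - e n by have := e_le n; lra.
have II n x : x \in `[a + e n, b - e n] -> x \in `]a, b[.
  by rewrite !in_itv/= => /andP[h1 h2]; have := e_gt0 n; lra.
have UI : `]a, b[%classic = \bigcup_n I n.
  apply/seteqP; split => [x /= xab|x [n _]]; last exact: II.
  have /andP[ax xb] : a < x < b by move: xab; rewrite in_itv.
  have : \forall n \near \oo, e n < Num.min (x - a) (b - x).
    by apply: (cvgr_lt _ e_cvg); rewrite lt_min; lra.
  move=> [n _ /(_ n (leqnn n))]; rewrite lt_min => /andP[h1 h2].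
  by exists n => //=; rewrite /I/= in_itv/=; lra.
have mf : measurable_fun `]a, b[ f.
  apply: open_continuous_measurable_fun => // x; rewrite inE => xab.
  exact: cf.
have step n : (\int[lebesgue_measure]_(x in I n) (f x)%:E =
    (F (b - e n) - F (a + e n))%:E)%E.
  have dI x : x \in `[a + e n, b - e n] -> derivable F x 1.
    by move=> /II /dF [].
  have cI : {within `[a + e n, b - e n], continuous F}.
    exact: derivable_within_continuous.
  have [_ cIa cIb] := (continuous_within_itvP F (ltI n)).1 cI.
  rewrite EFinB; apply: (continuous_FTC2 (ltI n)) => //.
  - apply: continuous_in_subspaceT => x; rewrite inE => /II; exact: cf.
  - split => // x xI; apply: dI; exact: subset_itv_oo_cc xI.
  - move=> x xI; have xab : x \in `]a, b[ by apply: (II n); exact: subset_itv_oo_cc xI.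
    by rewrite derive1E; have [_ ->] := dF _ xab.
have lim1 : (F (b - e n) - F (a + e n)) @[n --> \oo] --> lb - la.
  apply: cvgB.
    apply: (cvg_at_leftP F b lb).1 => //; split.
      by move=> n; rewrite ltrBlDr ltrDl.
    by rewrite -[X in _ --> X]subr0; apply: cvgB => //; exact: cvg_cst.
  apply: (cvg_at_rightP F a la).1 => //; split.
    by move=> n; rewrite ltrDl.
  by rewrite -[X in _ --> X]addr0; apply: cvgD => //; exact: cvg_cst.
have lim2 : (\int[lebesgue_measure]_(x in I n) (f x)%:E @[n --> \oo] -->
    \int[lebesgue_measure]_(x in \bigcup_n I n) (f x)%:E)%E.
  apply: ge0_nondecreasing_set_cvg_integral.
  - move=> m n mn; rewrite subsetEset => x; rewrite /I/= !in_itv/=.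
    by have := e_anti _ _ mn; lra.
  - by move=> n; exact: measurable_itv.
  - by move=> n; apply/measurable_EFinP; apply: measurable_funS mf => // x /II.
  - by move=> n x /II xab; rewrite lee_fin f0.
rewrite UI; apply: (cvg_unique _ lim2) => //.
apply: (@cvg_trans _ ((F (b - e n) - F (a + e n))%:E @[n --> \oo])).
  by apply: near_eq_cvg; apply: nearW => n /=; rewrite step.
by apply: cvg_EFin => //; exact: nearW.
Qed.

(** * The integral of the density *)

(** Applied to p, q and to 1 - q, 1 - p, this keeps the poles 0 and 1 of the density out of the open
    interval, even when an endpoint is itself a pole. *)
Lemma neq0_between (R : realDomainType) (p q x : R) :
  0 <= p * q -> p < x < q -> x != 0.
Proof.
move=> pq /andP[px xq]; apply/negP => /eqP x0.
by move: pq; rewrite leNgt nmulr_rlt0 -?x0 ?xq// x0.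
Qed.

Lemma continuous_sqrt_quadratic (R : realType) (c p q : R) :
  0 <= p * q -> 0 <= (1 - q) * (1 - p) ->
  {in `]p, q[, continuous (fun x : R =>
    c * (Num.sqrt ((x - p) * (q - x)) / (2 * pi * x * (1 - x))))}.
Proof.
move=> pq0 pq1 x; rewrite in_itv/= => /andP[px xq].
have x0 : x != 0 by apply: neq0_between pq0 _; rewrite px.
have x1 : 1 - x != 0.
  by apply: neq0_between pq1 _; rewrite !ltrD2l !ltrN2 xq.
have pi0 : pi != 0 :> R by rewrite gt_eqF// pi_gt0.
apply: cvgMr; apply: cvgM.
  apply: continuous_comp; last exact: sqrt_continuous.
  apply: cvgM; first by apply: cvgB => //; exact: cvg_cst.
  by apply: cvgB => //; exact: cvg_cst.
apply: cvgV; first by rewrite !mulf_neq0.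
apply: cvgM; last by apply: cvgB => //; exact: cvg_cst.
by apply: cvgMr.
Qed.

Lemma sqrt_quadratic_ge0 (R : realType) (c y x : R) : 0 <= c / (x * (1 - x)) ->
  0 <= c * (Num.sqrt y / (2 * pi * x * (1 - x))).
Proof.
move=> c0.
rewrite [leRHS](_ : _ = c / (x * (1 - x)) * (Num.sqrt y / (2 * pi))).
  by rewrite mulr_ge0// divr_ge0 ?sqrtr_ge0// mulr_ge0 ?pi_ge0.
rewrite -(mulrA (2 * pi)) (invfM (2 * pi)).
by move: (2 * pi)^-1 (x * (1 - x))^-1 => u v; ring.
Qed.

(** In t the integrand is c / pi times 1 / (1 + t^2) - p q / (p + q t^2) - (1 - p)(1 - q) / (1 - p +
    (1 - q) t^2). The three arctangents tend to pi / 2 times 1, k0 and k1 as t tends to +oo, and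
    vanish at t = 0. *)
Lemma integral_sqrt_quadratic (R : realType) (c p q k0 k1 : R) :
  p < q ->
  k0 ^+ 2 = p * q -> 0 <= k0 * q ->
  k1 ^+ 2 = (1 - p) * (1 - q) -> 0 <= k1 * (1 - q) ->
  {in `]p, q[, forall x : R, 0 <= c / (x * (1 - x))} ->
  (\int[lebesgue_measure]_(x in `]p, q[)
    (c * (Num.sqrt ((x - p) * (q - x)) / (2 * pi * x * (1 - x))))%:E =
    (c / 2 * (1 - k0 - k1))%:E)%E.
Proof.
move=> pq k0E k0q k1E k1q c0.
have pq0 : 0 <= p * q by rewrite -k0E sqr_ge0.
have pq1 : 0 <= (1 - q) * (1 - p) by rewrite mulrC -k1E sqr_ge0.
pose H (n k y : R) := k * atan (n / k * y).
pose t x := Num.sqrt ((x - p) / (q - x)).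
pose G y := c / pi * (H 1 1 y - H q k0 y - H (1 - q) k1 y).
have pi0 : pi != 0 :> R by rewrite gt_eqF// pi_gt0.
have xpq (x : R) : x \in `]p, q[ ->
    [/\ 0 < x - p, 0 < q - x, x != 0 & 1 - x != 0].
  rewrite in_itv/= => /andP[px xq]; rewrite !subr_gt0; split => //.
    by apply: neq0_between pq0 _; rewrite px.
  by apply: neq0_between pq1 _; rewrite !ltrD2l !ltrN2 xq.
rewrite [X in _ = X%:E](_ : _ = c / 2 * (1 - k0 - k1) - 0); last by rewrite subr0.
pose f x := c * (Num.sqrt ((x - p) * (q - x)) / (2 * pi * x * (1 - x))).
apply: (@ge0_continuous_FTC2_oo R f (G \o t) p q _ _ pq).
- by move=> x xI; apply: sqrt_quadratic_ge0; exact: c0.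
- exact: continuous_sqrt_quadratic.
- move=> x xI; have [px xq x0 x1] := xpq x xI.
  have w0 : 0 < t x by rewrite sqrtr_gt0 divr_gt0.
  have w2 : t x ^+ 2 = (x - p) / (q - x).
    by rewrite sqr_sqrtr// ltW// divr_gt0.
  have qp0 : q - p != 0 by rewrite subr_eq0 gt_eqF.
  have xq0 : q - x != 0 by rewrite gt_eqF.
  (* The three denominators become 1, x and 1 - x times the common factor (q - p) / (q - x), which
     cancels against the derivative of [t]. *)
  have E0 : 1 + 1 * t x ^+ 2 = (q - p) / (q - x) by rewrite w2; field.
  have E1 : p + q * t x ^+ 2 = x * (q - p) / (q - x) by rewrite w2; field.
  have E2 : 1 - p + (1 - q) * t x ^+ 2 = (1 - x) * (q - p) / (q - x).
    by rewrite w2; field.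
  have D0 : is_derive (t x) (1 : R) (H 1 1) (1 * 1 / (1 + 1 * t x ^+ 2)).
    by apply: is_derive_scaled_atan; rewrite ?expr1n ?mulr1// E0 !mulf_neq0 ?invr_eq0.
  have D1 : is_derive (t x) (1 : R) (H q k0) (p * q / (p + q * t x ^+ 2)).
    by apply: is_derive_scaled_atan => //; rewrite E1 !mulf_neq0 ?invr_eq0.
  have D2 : is_derive (t x) (1 : R) (H (1 - q) k1)
      ((1 - p) * (1 - q) / (1 - p + (1 - q) * t x ^+ 2)).
    by apply: is_derive_scaled_atan => //; rewrite E2 !mulf_neq0 ?invr_eq0.
  have DG := is_deriveZ (c / pi) (is_deriveB (is_deriveB D0 D1) D2).
  have xpq' : p < x < q by move: xI; rewrite in_itv.
  have DGt := @is_derive1_comp _ G t x _ _ DG (is_derive_sqrt_quotient _ _ _ _ xpq').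
  apply: is_derive_eq DGt _; rewrite /GRing.scale/= E0 E1 E2 -/(t x).
  rewrite /f; have -> : Num.sqrt ((x - p) * (q - x)) = t x * (q - x).
    rewrite [X in Num.sqrt X](_ : _ = (x - p) / (q - x) * (q - x) ^+ 2); last by field.
    by rewrite sqrtrM ?divr_ge0 ?ltW// sqrtr_sqr gtr0_norm.
  have wq : x - p = t x ^+ 2 * (q - x) by rewrite w2; field.
  (* The derivative of [t] carries a factor 1 / t, so t (q - x) is rewritten as (x - p) / t; both
     sides are then rational in x times 1 / t. *)
  rewrite [X in _ = X](_ : _ = c * (t x ^+ 2 * (q - x) / (t x * (2 * pi * x * (1 - x))))).
    rewrite -wq; move: (pi : R) pi0 => P P0; field.
    by rewrite x1 x0 P0 xq0 qp0 gt_eqF.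
  by move: (pi : R) pi0 => P P0; field; rewrite x0 x1 P0 gt_eqF.
- apply: cvg_at_right_filter.
  have t0 : t p = 0 by rewrite /t subrr mul0r sqrtr0.
  have -> : 0 = (G \o t) p by rewrite /= t0 /G /H !mulr0 !atan0 !mulr0 !subr0 mulr0.
  apply: continuous_comp.
    apply: continuous_comp; last exact: sqrt_continuous.
    apply: cvgM; first by apply: cvgB => //; exact: cvg_cst.
    apply: cvgV; first by rewrite subr_eq0 gt_eqF.
    by apply: cvgB => //; exact: cvg_cst.
  have cH n k : {for t p, continuous (H n k)}.
    apply: cvgMr; apply: continuous_comp; last exact: continuous_atan.
    by apply: cvgMr.
  by apply: cvgMr; apply: cvgB; [apply: cvgB|]; exact: cH.
- rewrite [X in _ --> X](_ : _ = c / pi * (1 * (pi / 2) - k0 * (pi / 2) - k1 * (pi / 2)));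
    last by move: (pi : R) pi0 => P P0; field.
  have cG : G y @[y --> +oo%R] -->
      c / pi * (1 * (pi / 2) - k0 * (pi / 2) - k1 * (pi / 2)).
    apply: cvgMr; apply: cvgB; [apply: cvgB|].
    + by apply: (@cvg_scaled_atan _ 1); rewrite ?mulr1 ?expr1n.
    + exact: (cvg_scaled_atan _ _ _ _ k0E).
    + exact: (cvg_scaled_atan _ _ _ _ k1E).
  exact: (cvg_comp _ _ (cvg_sqrt_quotient _ _ _ pq) cG).
Qed.

(** * The endpoints in terms of real square roots *)

Lemma sqrtr_mulN (R : rcfType) (a : R) : Num.sqrt a * Num.sqrt (- a) = 0.
Proof.
have [a0|/ltW a0] := leP a 0; first by rewrite ler0_sqrtr// mul0r.
by rewrite [X in _ * X]ler0_sqrtr ?mulr0// oppr_le0.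
Qed.

Lemma sqr_sqrtrB (R : rcfType) (a : R) :
  Num.sqrt a ^+ 2 - Num.sqrt (- a) ^+ 2 = a.
Proof.
have [a0|/ltW a0] := leP a 0.
  by rewrite ler0_sqrtr// sqr_sqrtr ?oppr_ge0// expr0n sub0r opprK.
by rewrite sqr_sqrtr// ler0_sqrtr ?oppr_le0// expr0n subr0.
Qed.

(** [Num.sqrt] vanishes on nonpositive reals, so one formula covers both signs of a. *)
Lemma sqrtc_real (R : rcfType) (a : R) :
  sqrtc a%:C = Num.sqrt a +i* Num.sqrt (- a).
Proof.
rewrite /sqrtc/= eqxx expr0n addr0 sqrtr_sqr mul1r.
have [a0|/ltW a0] := leP a 0.
  rewrite ler0_norm// addNr mul0r sqrtr0 (ler0_sqrtr a0).
  by congr (_ +i* Num.sqrt _); field.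
rewrite ger0_norm// subrr mul0r sqrtr0 (@ler0_sqrtr _ (- a)) ?oppr_le0//.
by congr (Num.sqrt _ +i* _); field.
Qed.

Lemma x_minusE (R : realType) (s t : R) (a := radicand1 s t) (b := radicand2 s t) :
  x_minus s t =
  (a + b - 2 * (Num.sqrt a * Num.sqrt b - Num.sqrt (- a) * Num.sqrt (- b))) +i*
  (- 2 * (Num.sqrt a * Num.sqrt (- b) + Num.sqrt b * Num.sqrt (- a))).
Proof.
rewrite /x_minus !sqrtc_real -/a -/b expr2; simpc.
apply/eqP; rewrite eq_complex/=; apply/andP; split; apply/eqP.
  by have := sqr_sqrtrB _ a; have := sqr_sqrtrB _ b; lra.
by have := sqrtr_mulN _ a; have := sqrtr_mulN _ b; lra.
Qed.

Lemma x_plusE (R : realType) (s t : R) (a := radicand1 s t) (b := radicand2 s t) :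
  x_plus s t =
  (a + b + 2 * (Num.sqrt a * Num.sqrt b - Num.sqrt (- a) * Num.sqrt (- b))) +i*
  (2 * (Num.sqrt a * Num.sqrt (- b) + Num.sqrt b * Num.sqrt (- a))).
Proof.
rewrite /x_plus !sqrtc_real -/a -/b expr2; simpc.
apply/eqP; rewrite eq_complex/=; apply/andP; split; apply/eqP.
  by have := sqr_sqrtrB _ a; have := sqr_sqrtrB _ b; lra.
by have := sqrtr_mulN _ a; have := sqrtr_mulN _ b; lra.
Qed.

(** The left side is, up to a factor 2 or -2, the imaginary part of either endpoint. Its terms are
    nonnegative, so both must vanish. *)
Lemma sqrtr_cross_eq0 (R : rcfType) (a b : R) :
  (Num.sqrt a * Num.sqrt (- b) + Num.sqrt b * Num.sqrt (- a) == 0) = (0 <= a * b).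
Proof.
rewrite paddr_eq0; [|by rewrite mulr_ge0 ?sqrtr_ge0..].
rewrite !mulf_eq0 !sqrtr_eq0 !oppr_le0.
have [a0|a0|->] := ltgtP a 0; have [b0|b0|->] := ltgtP b 0; rewrite ?mul0r ?mulr0 ?lexx//=.
- by rewrite nmulr_lge0// ltW.
- by rewrite nmulr_rge0// leNgt b0.
- by rewrite pmulr_rge0// leNgt b0.
- by rewrite pmulr_rge0// ltW.
Qed.

Lemma sqr_sqrtr_mulB (R : rcfType) (a b : R) : 0 <= a * b ->
  (Num.sqrt a * Num.sqrt b - Num.sqrt (- a) * Num.sqrt (- b)) ^+ 2 = a * b.
Proof.
rewrite -sqrtr_cross_eq0 => /eqP E.
have Z := sqrtr_mulN _ a.
transitivity ((Num.sqrt a ^+ 2 - Num.sqrt (- a) ^+ 2) *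
              (Num.sqrt b ^+ 2 - Num.sqrt (- b) ^+ 2)); last by rewrite !sqr_sqrtrB.
(* In this expansion of the square, the added square vanishes by [E] and the last product by [Z]. *)
transitivity ((Num.sqrt a ^+ 2 - Num.sqrt (- a) ^+ 2) *
    (Num.sqrt b ^+ 2 - Num.sqrt (- b) ^+ 2) +
    (Num.sqrt a * Num.sqrt (- b) + Num.sqrt b * Num.sqrt (- a)) ^+ 2 -
    4 * (Num.sqrt a * Num.sqrt (- a)) * (Num.sqrt b * Num.sqrt (- b))); first by ring.
by rewrite E Z; ring.
Qed.

Lemma radicand_mul (R : realType) (s t : R) : s + t != 0 ->
  radicand1 s t * radicand2 s t = s * t * (s + t - 1) / (s + t) ^+ 4.
Proof. by move=> D0; rewrite /radicand1 /radicand2; field. Qed.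

(** With radicands a and b, p + q = 2 (a + b) and p q = (a - b)^2. All the identities follow from
    these symmetric functions, whichever endpoint is the larger. *)
Lemma fb_endpoints (R : realType) (s t : R) (D := s + t)
    (p := Num.min (xm s t) (xp s t)) (q := Num.max (xm s t) (xp s t)) :
  D != 0 -> 0 <= s * t * (D - 1) ->
  [/\ p <= q, D ^+ 4 * (q - p) ^+ 2 = 16 * (s * t * (D - 1)),
      p * q = ((s - 1) / D) ^+ 2, (1 - p) * (1 - q) = ((t - 1) / D) ^+ 2 &
      D ^+ 2 * (p + q) = 2 * (s * (D - 1) + t)].
Proof.
move=> D0 std.
have [E1 E2] : p + q = xm s t + xp s t /\ p * q = xm s t * xp s t.
  by rewrite /p /q; case: leP => _; split => //; [exact: addrC|exact: mulrC].
have pq : p <= q by rewrite /p /q ge_min !le_max lexx.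
have ab0 : 0 <= radicand1 s t * radicand2 s t.
  by rewrite radicand_mul// divr_ge0// exprn_even_ge0.
have K := sqr_sqrtr_mulB _ _ _ ab0.
have E3 : p + q = 2 * (radicand1 s t + radicand2 s t).
  by rewrite E1 /xm /xp x_minusE x_plusE /=; ring.
have E4 : p * q = (radicand1 s t - radicand2 s t) ^+ 2.
  rewrite E2 /xm /xp x_minusE x_plusE /=.
  by move: K; set k := _ - Num.sqrt (- _) * _ => K; lra.
split => //.
- rewrite (_ : (q - p) ^+ 2 = (p + q) ^+ 2 - 4 * (p * q)); last by ring.
  by rewrite E3 E4 /radicand1 /radicand2 /D; field.
- by rewrite E4 /radicand1 /radicand2 /D; field.
- rewrite (_ : (1 - p) * (1 - q) = 1 - (p + q) + p * q); last by ring.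
  by rewrite E3 E4 /radicand1 /radicand2 /D; field.
- by rewrite E3 /radicand1 /radicand2 /D; field.
Qed.

(** The quadratic under the root is unchanged when the endpoints are exchanged. *)
Lemma fb_density_minmax (R : realType) (s t x : R)
    (p := Num.min (xm s t) (xp s t)) (q := Num.max (xm s t) (xp s t)) :
  fb_density s t x =
  (s + t) * (Num.sqrt ((x - p) * (q - x)) / (2 * pi * x * (1 - x))).
Proof.
rewrite /fb_density; congr (_ * (Num.sqrt _ / _)).
by rewrite /p /q; case: leP => _; ring.
Qed.

(** * Position of the interval relative to 0 and 1, and the total mass *)

Lemma both_ge0 (R : realDomainType) (p q : R) :
  p <= q -> 0 <= p * q -> 0 < p + q -> 0 <= p.
Proof.
move=> pq h1 h2; rewrite leNgt; apply/negP => p0.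
by have q0 : 0 < q by [lra|]; move: h1; rewrite nmulr_rge0//; lra.
Qed.

Lemma both_le0 (R : realDomainType) (p q : R) :
  p <= q -> 0 <= p * q -> p + q < 0 -> q <= 0.
Proof.
move=> pq h1 h2; rewrite -oppr_ge0; apply: (@both_ge0 _ (- q) (- p)); lra.
Qed.

(** The weight is the positive part of 1 - s; in this form its absolute value cancels the one in k0
    or k1. *)
Lemma atom_weight_pos (R : realDomainType) (s : R) : 0 < s ->
  2 * ((1 - s) * (0 < s < 1)%R%:R) = 1 - s + `|s - 1|.
Proof.
move=> s0; rewrite s0/=; have [s1|s1] := ltP s 1; rewrite ?mulr1 ?mulr0/=.
  by rewrite ltr0_norm ?subr_lt0//; ring.
by rewrite ger0_norm ?subr_ge0//; ring.
Qed.

Lemma atom_weight_neg (R : realDomainType) (s : R) : s < 0 ->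
  (1 - s) * (0 < s < 1)%R%:R = 0.
Proof. by move=> s0; rewrite ltNge ltW// mulr0. Qed.

(** Here s t < 0. If s < 0, then D^2 ((1 - p) + (1 - q)) = 2 (t (D - 1) + s) is negative while (1 -
    p)(1 - q) is a square, so neither factor is positive. If t < 0, the same argument applies to p
    and q. *)
Lemma fb_interval_outside (R : realType) (s t : R) (D := s + t)
    (p := Num.min (xm s t) (xp s t)) (q := Num.max (xm s t) (xp s t)) :
  D != 0 -> D < 1 -> 0 < s * t * (D - 1) ->
  [/\ s < 0, 0 < t & 1 <= p] \/ [/\ 0 < s, t < 0 & q <= 0].
Proof.
move=> D0 D1 std; have [pq _ pqE pqE1 pDq] := fb_endpoints _ _ _ D0 (ltW std).
rewrite -/D -/p -/q in pq pqE pqE1 pDq.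
have D2 : 0 < D ^+ 2 by rewrite exprn_even_gt0.
have st : s * t < 0 by move: std; rewrite nmulr_lgt0// subr_lt0.
have /lt_total/orP[s0|s0] : s != 0.
  by apply: contraTneq st => ->; rewrite mul0r ltxx.
- left; have t0 : 0 < t by move: st; rewrite nmulr_rlt0.
  split => //; rewrite -subr_le0.
  apply: (@both_le0 _ (1 - q)); first lra.
    by rewrite mulrC pqE1 sqr_ge0.
  rewrite -(pmulr_rlt0 _ D2).
  have -> : D ^+ 2 * ((1 - q) + (1 - p)) = 2 * D ^+ 2 - D ^+ 2 * (p + q) by ring.
  have : t * (D - 1) < 0 by rewrite pmulr_rlt0//; lra.
  by rewrite pDq /D; lra.
- right; have t0 : t < 0 by move: st; rewrite pmulr_rlt0.
  split => //; apply: both_le0 pq _ _; first by rewrite pqE sqr_ge0.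
  rewrite -(pmulr_rlt0 _ D2) pDq.
  have : s * (D - 1) < 0 by rewrite pmulr_rlt0//; lra.
  by lra.
Qed.

Lemma fb_region_mass (R : realType) (s t : R) (D := s + t)
    (p := Num.min (xm s t) (xp s t)) (q := Num.max (xm s t) (xp s t)) :
  D != 0 -> 0 < s * t * (D - 1) -> D < 0 \/ 1 < D ->
  exists k0 k1, [/\ k0 ^+ 2 = p * q /\ 0 <= k0 * q,
    k1 ^+ 2 = (1 - p) * (1 - q) /\ 0 <= k1 * (1 - q),
    {in `]p, q[, forall x : R, 0 <= D / (x * (1 - x))} &
    (1 - s) * (0 < s < 1)%R%:R + D / 2 * (1 - k0 - k1)
      + (1 - t) * (0 < t < 1)%R%:R = 1].
Proof.
move=> D0 std HD; have [pq _ pqE pqE1 pDq] := fb_endpoints _ _ _ D0 (ltW std).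
rewrite -/D -/p -/q in pq pqE pqE1 pDq.
have pq0 : 0 <= p * q by rewrite pqE sqr_ge0.
have pq1 : 0 <= (1 - q) * (1 - p) by rewrite mulrC pqE1 sqr_ge0.
have D2 : 0 < D ^+ 2 by rewrite exprn_even_gt0.
have qp' : 1 - q <= 1 - p by rewrite lerD2l lerN2.
have pDq1 : D ^+ 2 * ((1 - q) + (1 - p)) = 2 * (t * (D - 1) + s).
  have -> : D ^+ 2 * ((1 - q) + (1 - p)) = 2 * D ^+ 2 - D ^+ 2 * (p + q) by ring.
  by rewrite pDq /D; ring.
have K (r : R) : (`|r| / D) ^+ 2 = (r / D) ^+ 2.
  by rewrite !expr_div_n real_normK ?num_real.
(* For D > 1 both parameters are positive and the interval lies in [0, 1], so both roots are taken
   nonnegative. *)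
have [D1|D1] := ltP 1 D.
  have [s0 t0] : 0 < s /\ 0 < t.
    have st : 0 < s * t by rewrite -(pmulr_lgt0 _ (_ : 0 < D - 1)) ?subr_gt0.
    have [s0|s0] := ltP 0 s; first by split => //; rewrite -(pmulr_rgt0 _ s0).
    have t0 : 0 < t by rewrite /D in D1; lra.
    by move: st; rewrite pmulr_lgt0// ltNge s0.
  have p0 : 0 <= p.
    apply: both_ge0 pq pq0 _; rewrite -(pmulr_rgt0 _ D2) pDq.
    by rewrite mulr_gt0// addr_gt0// mulr_gt0// subr_gt0.
  have q1 : 0 <= 1 - q.
    apply: both_ge0 qp' pq1 _; rewrite -(pmulr_rgt0 _ D2) pDq1.
    by rewrite mulr_gt0// addr_gt0// mulr_gt0// subr_gt0.
  exists (`|s - 1| / D), (`|t - 1| / D); split.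
  - split; first by rewrite K.
    by rewrite mulr_ge0 ?divr_ge0//; lra.
  - split; first by rewrite K.
    by rewrite mulr_ge0 ?divr_ge0//; lra.
  - move=> x; rewrite in_itv/= => /andP[px xq].
    by rewrite divr_ge0 ?mulr_ge0//; lra.
  - have -> : D / 2 * (1 - `|s - 1| / D - `|t - 1| / D) =
        (D - `|s - 1| - `|t - 1|) / 2 by field.
    by have := atom_weight_pos _ _ s0; have := atom_weight_pos _ _ t0; rewrite /D; lra.
have {D1 HD}D1 : D < 0 by case: HD => // /lt_geF; rewrite D1.
have [[s0 t0 q1]|[s0 t0 p1]] :=
  fb_interval_outside _ _ _ D0 (lt_trans D1 ltr01) std.
- rewrite -/p in q1.
  (* The interval lies to the right of 1, so k0 must be nonnegative and k1 nonpositive. There is no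
     atom at 0, and s - 1 appears without absolute value. *)
  exists ((s - 1) / D), (`|t - 1| / D); split.
  - split; first by rewrite pqE.
    rewrite mulr_ge0//; last lra.
    by rewrite -mulrNN mulr_ge0 ?oppr_ge0 ?invr_le0; lra.
  - split; first by rewrite K.
    rewrite -mulrNN mulr_ge0//; last lra.
    by rewrite -mulrN mulr_ge0// oppr_ge0 invr_le0; lra.
  - move=> x; rewrite in_itv/= => /andP[px xq].
    by rewrite nmulr_rge0// invr_le0 mulr_ge0_le0//; lra.
  - have -> : D / 2 * (1 - (s - 1) / D - `|t - 1| / D) =
        (D - (s - 1) - `|t - 1|) / 2 by field.
    by have := atom_weight_neg _ _ s0; have := atom_weight_pos _ _ t0; rewrite /D; lra.
rewrite -/q in p1.
(* The mirror case: the interval lies to the left of 0 and the atom at 1 is absent. *)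
exists (`|s - 1| / D), ((t - 1) / D); split.
- split; first by rewrite K.
  rewrite -mulrNN mulr_ge0//; last lra.
  by rewrite -mulrN mulr_ge0// oppr_ge0 invr_le0; lra.
- split; first by rewrite pqE1.
  rewrite mulr_ge0//; last lra.
  by rewrite -mulrNN mulr_ge0 ?oppr_ge0 ?invr_le0; lra.
- move=> x; rewrite in_itv/= => /andP[px xq].
  by rewrite nmulr_rge0// invr_le0 mulr_le0_ge0//; lra.
- have -> : D / 2 * (1 - `|s - 1| / D - (t - 1) / D) =
      (D - `|s - 1| - (t - 1)) / 2 by field.
  by have := atom_weight_pos _ _ s0; have := atom_weight_neg _ _ t0; rewrite /D; lra.
Qed.

(** * Construction of the measure for parameters in the region *)

Lemma fb_defines_probability (R : realType) (s t : R) (D := s + t) :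
  D != 0 -> 0 < s * t * (D - 1) -> D < 0 \/ 1 < D -> defines_probability s t.
Proof.
move=> D0 std HD.
have ab : 0 <= radicand1 s t * radicand2 s t.
  by rewrite radicand_mul// divr_ge0 ?(ltW std)// exprn_even_ge0.
have /eqP E : Num.sqrt (radicand1 s t) * Num.sqrt (- radicand2 s t) +
    Num.sqrt (radicand2 s t) * Num.sqrt (- radicand1 s t) == 0.
  by rewrite sqrtr_cross_eq0.
have [pq dqp pqE pqE1 _] := fb_endpoints _ _ _ D0 (ltW std).
have [k0 [k1 [[k0E k0q] [k1E k1q] c0 mass]]] := fb_region_mass _ _ _ D0 std HD.
(* The strict inequality for s t (D - 1) makes the interval nondegenerate, since D^4 (q - p)^2 is 16
   times it. *)
have pq' : Num.min (xm s t) (xp s t) < Num.max (xm s t) (xp s t).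
  rewrite lt_neqAle pq andbT; apply: contraTneq std => pqeq.
  rewrite -(pmulr_rgt0 _ (_ : 0 < 16)) // -dqp pqeq subrr expr0n mulr0.
  by rewrite ltxx.
split; [by rewrite x_minusE/= E mulr0|by rewrite x_plusE/= E mulr0|].
pose I : set (measurableTypeR R) := fb_interval s t.
have mI : measurable I by exact: measurable_itv.
pose f := fb_density s t.
have fE : f = fun x => D * (Num.sqrt ((x - Num.min (xm s t) (xp s t)) *
    (Num.max (xm s t) (xp s t) - x)) / (2 * pi * x * (1 - x))).
  by apply/funext => x; rewrite /f fb_density_minmax.
have f0 x : I x -> 0 <= f x.
  move=> Ix; rewrite fE.
  by apply: sqrt_quadratic_ge0; exact: c0.
have intE : (\int[lebesgue_measure]_(x in I) (f x)%:E = (D / 2 * (1 - k0 - k1))%:E)%E.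
  by rewrite fE; apply: integral_sqrt_quadratic.
(* The density is continuous and nonnegative on the interval, so its finite integral gives
   integrability. *)
have intf : lebesgue_measure.-integrable I (EFin \o f).
  apply/integrableP; split.
    apply/measurable_EFinP; rewrite fE; apply: open_continuous_measurable_fun => //.
    move=> x; rewrite inE; apply: continuous_sqrt_quadratic.
      by rewrite -k0E sqr_ge0.
    by rewrite mulrC -k1E sqr_ge0.
  apply: (@le_lt_trans _ _ (\int[lebesgue_measure]_(x in I) (f x)%:E)%E).
    rewrite le_eqVlt; apply/orP; left; apply/eqP; apply: eq_integral => x.
    by rewrite inE => /f0 fx; rewrite /= ger0_norm.
  by rewrite intE ltry.
(* The density is extended by 0 so that it induces a charge on the whole line. *)
have intf' : lebesgue_measure.-integrable setT ((EFin \o f) \_ I).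
  exact: (integrable_mkcond _ mI).1.
pose m0 := (1 - s) * (0 < s < 1)%R%:R.
pose m1 := (1 - t) * (0 < t < 1)%R%:R.
pose nu := cadd (cadd (cscale m0 (charge_of_finite_measure (dirac (0 : measurableTypeR R))))
   (induced_charge intf'))
   (cscale m1 (charge_of_finite_measure (dirac (1 : measurableTypeR R)))).
have nuE (A : set (measurableTypeR R)) : nu A = fb_formula s t A.
  rewrite /nu /cadd /= /cscale /induced_charge /fb_formula /fb_ac_part.
  by rewrite integral_mkcondr.
have atom_ge0 (r : R) : 0 <= (1 - r) * (0 < r < 1)%R%:R.
  by case: andP => [[_ r1]|_]; rewrite ?mulr0// mulr1 subr_ge0 ltW.
exists nu; split => //.
- move=> A mA; rewrite [leRHS]nuE; apply: adde_ge0; [apply: adde_ge0|].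
  + by rewrite mule_ge0 ?lee_fin.
  + by apply: integral_ge0 => x [_ /f0]; rewrite lee_fin.
  + by rewrite mule_ge0 ?lee_fin.
- rewrite [LHS]nuE /fb_formula /fb_ac_part setTI intE !diracT !mule1 -!EFinD.
  by rewrite mass.
Qed.

(** * Failure outside the region, and the equivalence *)

(** The interval lies beyond 1 or below 0, where x (1 - x) <= 0, while D > 0. *)
Lemma fb_ac_part_le0 (R : realType) (s t : R) (D := s + t) :
  0 < D < 1 -> 0 < s * t * (D - 1) -> (fb_ac_part s t setT <= 0)%E.
Proof.
move=> /andP[D0 D1] std; rewrite /fb_ac_part setTI.
have out := fb_interval_outside _ _ _ (lt0r_neq0 D0) D1 std.
have f0 x : fb_interval s t x -> (0 <= (- fb_density s t x)%:E)%E.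
  move=> Ix; rewrite lee_fin fb_density_minmax -mulNr.
  apply: sqrt_quadratic_ge0; rewrite nmulr_rge0 ?oppr_lt0// invr_le0.
  move: Ix; rewrite /fb_interval/= in_itv/= => /andP[px xq].
  by case: out => [[_ _ p1]|[_ _ q0]]; [rewrite mulr_ge0_le0|rewrite mulr_le0_ge0]; lra.
rewrite (_ : integral _ _ _ =
    (- \int[lebesgue_measure]_(x in fb_interval s t) (- fb_density s t x)%:E)%E).
  by rewrite oppe_le0 integral_ge0.
rewrite -integral_ge0N//; apply: eq_integral => x _.
by rewrite -EFinN opprK.
Qed.

Theorem proposition3p1 (R : realType) (sigma theta : R)
    (h0 : sigma + theta <> 0) (h1 : sigma + theta <> 1) :
  defines_probability sigma theta <-> fb_region (sigma, theta).
Proof.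
have D0 : sigma + theta != 0 by apply/eqP.
have D1 : sigma + theta - 1 != 0 by rewrite subr_eq0; apply/eqP.
pose E := sigma * theta * (sigma + theta - 1).
have E2 : sigma * theta / (sigma + theta - 1) = E / (sigma + theta - 1) ^+ 2.
  by rewrite /E; field.
have D2 : 0 < (sigma + theta - 1) ^+ 2 by rewrite exprn_even_gt0.
split=> [|[/= HD]]; last first.
  rewrite E2 pmulr_lgt0 ?invr_gt0// => E0.
  apply: fb_defines_probability => //.
  (* The first region condition excludes exactly 0 < D < 1. *)
  have [D|D|D] := ltgtP (sigma + theta) 0; [by left|right| by rewrite D eqxx in D0].
  by rewrite -subr_gt0 -invr_gt0 -(pmulr_rgt0 _ D).
move=> [Im0 _ [nu [nuE _ nu1]]].
have mass : fb_formula sigma theta setT = 1%E.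
  by rewrite -nuE.
(* Reality of the endpoint [x_minus] alone gives this sign. *)
have E_ge0 : 0 <= E.
  have : 0 <= radicand1 sigma theta * radicand2 sigma theta.
    rewrite -sqrtr_cross_eq0; move: Im0; rewrite x_minusE/= => /eqP.
    by rewrite mulf_eq0 oppr_eq0 pnatr_eq0.
  by rewrite radicand_mul// pmulr_lge0// invr_gt0 exprn_even_gt0.
move: mass; rewrite /fb_formula !diracT !mule1.
have [Epos|E0] := ltP 0 E; last first.
  (* When E = 0 the interval is empty and a parameter is 0, so at most one atom remains, of mass
     less than 1. *)
  have {}E0 : E = 0 by apply/eqP; rewrite eq_le E0.
  have [pq dqp _ _ _] := fb_endpoints _ _ _ D0 E_ge0.
  have pqE : Num.min (xm sigma theta) (xp sigma theta) =
      Num.max (xm sigma theta) (xp sigma theta).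
    apply/eqP; rewrite eq_sym -subr_eq0; move/eqP: dqp.
    by rewrite -/E E0 mulr0 mulf_eq0 !expf_eq0/= (negbTE D0).
  rewrite /fb_ac_part /fb_interval pqE set_itvoo0// setI0 integral_set0 adde0.
  rewrite -EFinD => -[mass]; exfalso.
  move/eqP: E0; rewrite /E !mulf_eq0 (negbTE D1) orbF => /orP[] /eqP z0.
    move: mass; rewrite z0 ltxx mulr0 add0r.
    by case: andP => [[t0 _]|_]; rewrite ?mulr1 ?mulr0/=; lra.
  move: mass; rewrite z0 ltxx mulr0 addr0.
  by case: andP => [[t0 _]|_]; rewrite ?mulr1 ?mulr0/=; lra.
move=> mass; split=> /=; last by rewrite E2 divr_gt0.
have [D|D|D] := ltgtP (sigma + theta) 0; last by rewrite D eqxx in D0.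
  by rewrite -mulrNN mulr_gt0 ?oppr_gt0// invr_lt0; lra.
(* If 0 < D < 1, the continuous part has mass at most 0, so the atoms would need mass at least 1;
   but only one parameter is positive, and its atom weighs less than 1. *)
rewrite divr_gt0// lt_neqAle eq_sym D1/= leNgt; apply/negP => D'.
have Dlt1 : sigma + theta < 1 by rewrite -subr_lt0.
have ac : (fb_ac_part sigma theta setT <= 0)%E.
  by apply: fb_ac_part_le0 => //; rewrite D Dlt1.
have: (1%:E <= ((1 - sigma) * (0 < sigma < 1)%R%:R +
    (1 - theta) * (0 < theta < 1)%R%:R)%:E)%E.
  by rewrite -mass EFinD leeD2r// geeDl.
rewrite lee_fin; apply/negP; rewrite -ltNge.
have w (r : R) : 0 < r -> (1 - r) * (0 < r < 1)%R%:R < 1.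
  by move=> r0; case: andP => _; rewrite ?mulr1 ?mulr0//; lra.
have [[s0 t0 _]|[s0 t0 _]] := fb_interval_outside _ _ _ D0 Dlt1 Epos.
  by rewrite atom_weight_neg// add0r w.
by rewrite [X in _ + X]atom_weight_neg// addr0 w.
Qed.
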